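(* Let $t_1<t_2$ be real numbers and consider the (not necessarily periodic) linear impulsive Hamiltonian system $$x'=a(t)x+b(t)u,\quad u'=-c(t)x-a(t)u,\quad t\neq\tau_i,$$ $$x(\tau_i+)=\alpha_i x(\tau_i-),\quad u(\tau_i+)=\alpha_i u(\tau_i-)-\beta_i x(\tau_i-),\qquad i\in\mathbb Z,$$ where $a,b,c\in\mathrm{PC}[t_1,t_2]$, $b(t)>0$, and $\alpha_i,\beta_i$ are real numbers with $\alpha_i\neq0$ for all $i\in\mathbb Z$. Suppose that the system has a real solution $(x(t),u(t))$ such that $x(t_1+)=x(t_2-)=0$ and $x(t)\neq0$ on $(t_1,t_2)$. Then the inequality $$\left[\int_{t_1}^{t_2}b(t)\exp\left(-2\int_{t_0}^{t}a(u)\,du\right)dt\right]\left[\int_{t_1}^{t_2}c^+(t)\,dt+\sum_{t_1\le\tau_i<t_2}\left(\frac{\beta_i}{\alpha_i}\right)^+\right]\ge4$$ holds for some $t_0\in(t_1,t_2)$.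
   Context: $\{\tau_i\}_{i\in\mathbb Z}$ is a sequence of real numbers (impulse points) with $\tau_i<\tau_{i+1}$ for all $i$, only finitely many of which lie in $[t_1,t_2]$. No periodicity is assumed. $\mathrm{PC}[t_1,t_2]$ is the set of real-valued functions $f:[t_1,t_2]\setminus\{\tau_i:i\in\mathbb Z\}\to\mathbb R$ that are continuous on $[t_1,t_2]\setminus\{\tau_i:i\in\mathbb Z\}$ and for which the left limit $f(\tau_i-)$ and the right limit $f(\tau_i+)$ exist (finite) at each impulse point $\tau_i$ in the interval (at an endpoint, only the one-sided limit from within the interval). A solution is a pair $(x,u)$ satisfying the differential equations for $t\neq\tau_i$, having one-sided limits at the impulse points, and satisfying the jump conditions there. A zero of $x$ is a real number $s$ with $x(s-)=0$ or $x(s+)=0$ (at a point of continuity this is $x(s)=0$); ''$x(t)\neq0$ on $(t_1,t_2)$'' means that $x$ has no zero in $(t_1,t_2)$ in this sense. Notation: $c^+(t)=\max\{c(t),0\}$ and $(\beta_i/\alpha_i)^+=\max\{\beta_i/\alpha_i,0\}$. *)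

(* Defs.v *)
From Stdlib Require Import Reals ZArith List ClassicalEpsilon.
From Coquelicot Require Import Coquelicot.

Local Open Scope R_scope.

(* f(s-) = l and f(s+) = l *)
Definition left_lim (f : R -> R) (s l : R) : Prop :=
  filterlim f (at_left s) (locally l).

Definition right_lim (f : R -> R) (s l : R) : Prop :=
  filterlim f (at_right s) (locally l).

(* The set [t1, t2] \ {tau_i : i in Z}. Functions on it are represented by
   total functions R -> R whose values elsewhere are irrelevant. *)
Definition impulse_free (tau : Z -> R) (t1 t2 t : R) : Prop :=
  t1 <= t <= t2 /\ forall i : Z, t <> tau i.

(* Finite one-sided limits at every impulse point of [t1, t2]; at an endpoint,
   only the limit from within the interval. *)
Definition has_one_sided_limits (tau : Z -> R) (t1 t2 : R) (f : R -> R) : Prop :=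
  (forall i : Z, t1 < tau i <= t2 -> exists l : R, left_lim f (tau i) l) /\
  (forall i : Z, t1 <= tau i < t2 -> exists l : R, right_lim f (tau i) l).

Definition PC (tau : Z -> R) (t1 t2 : R) (f : R -> R) : Prop :=
  continuous_on (impulse_free tau t1 t2) f /\
  has_one_sided_limits tau t1 t2 f.

(* The derivatives are relative to [t1, t2] \ {tau_i}: two-sided at interior
   points, one-sided at an endpoint that is not an impulse point. The jump
   conditions involve both one-sided limits, hence concern the impulse points
   of the open interval. *)
Definition is_solution (tau alpha beta : Z -> R) (a b c : R -> R) (t1 t2 : R)
    (x u : R -> R) : Prop :=
  (forall t : R, impulse_free tau t1 t2 t ->
     D_in x (fun s => a s * x s + b s * u s) (impulse_free tau t1 t2) t /\
     D_in u (fun s => - c s * x s - a s * u s) (impulse_free tau t1 t2) t) /\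
  has_one_sided_limits tau t1 t2 x /\
  has_one_sided_limits tau t1 t2 u /\
  (forall i : Z, t1 < tau i < t2 ->
     exists xl xr ul ur : R,
       left_lim x (tau i) xl /\ right_lim x (tau i) xr /\
       left_lim u (tau i) ul /\ right_lim u (tau i) ur /\
       xr = alpha i * xl /\
       ur = alpha i * ul - beta i * xl).

Definition is_zero (x : R -> R) (s : R) : Prop :=
  left_lim x s 0 \/ right_lim x s 0.

(* The sum of f over the indices satisfying P; unspecified when there are
   infinitely many of them. *)
Definition sum_over (P : Z -> Prop) (f : Z -> R) : R :=
  epsilon (inhabits 0) (fun s : R =>
    exists l : list Z, NoDup l /\ (forall i : Z, In i l <-> P i) /\
      s = fold_right Rplus 0 (map f l)).

(* Main.v *)
Require Import Defs.
From Stdlib Require Import Reals ZArith Finite_sets List Lra Lia.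
From Stdlib Require Import Classical ClassicalEpsilon.
From Coquelicot Require Import Coquelicot.

Local Open Scope R_scope.

(** Let w(t) be the product of the 1 / |alpha_i| over the impulse points in
[t1, t). The function Z = |x| w has no jumps: it extends to a continuous function on
[t1, t2] which vanishes at t1 and t2 and is not identically 0
([solution_amplitude]). Let t0 be a point where Z is maximal, M = Z(t0) > 0 and
E(t) = exp(- integral of a from t0 to t). Away from the impulses
(Z E)' = sign(x) b u w E, and K = x u w^2 satisfies K' = b u^2 w^2 - c x^2 w^2;
at tau_i, K drops by (beta_i / alpha_i) Z(tau_i)^2. For every lambda > 0, the
identity
<<
  lambda b E^2 -+ 2 sign(x) b u w E + b u^2 w^2 / lambda
    = (b / lambda) (lambda E -+ sign(x) u w)^2 >= 0
>>
together with Z <= M shows that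
<<
  G = lambda * integral of b E^2
      + (M^2 / lambda) * (integral of c^+ + sum of the (beta_i / alpha_i)^+)
      + K / lambda + Phi
>>
is nondecreasing on (t1, t2), jumps included; the integrals run from
t1 to t and the sum over t1 <= tau_i < t, and Phi is the continuous function equal to
- 2 Z E on [t1, t0] and to 2 Z E - 4 M on [t0, t2]. As x, hence K, vanishes at
both ends and Phi goes from 0 to - 4 M, comparing the ends gives
4 M <= lambda A + (M^2 / lambda) C, where A and C are the two factors of the
conclusion ([energy_inequality]). This for all lambda > 0 forces A C >= 4
([product_ge_4]); choosing lambda = 2 M / A plays the part of the
Cauchy-Schwarz inequality.

The data are continuous only between impulses, so everything rests on two facts
about functions with finitely many breakpoints: nonnegative derivative and upward
jumps imply monotonicity ([piecewise_nondecreasing]), and piecewise continuous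
functions are integrable ([piecewise_continuous_ex_RInt]). Coefficients are
extended by 0 outside (t1, t2), so that their primitives are continuous on the
whole line. *)

(** * One-sided limits *)

Lemma filterlim_Rplus {T : Type} (F : (T -> Prop) -> Prop) {FF : Filter F}
    (f g : T -> R) (k l : R) :
  filterlim f F (locally k) -> filterlim g F (locally l) ->
  filterlim (fun t => f t + g t) F (locally (k + l)).
Proof.
intros Hf Hg; apply (filterlim_comp_2 (G := locally k) (H := locally l)); auto.
exact (filterlim_plus (K := R_AbsRing) (V := R_NormedModule) k l).
Qed.

Lemma filterlim_Rmult {T : Type} (F : (T -> Prop) -> Prop) {FF : Filter F}
    (f g : T -> R) (k l : R) :
  filterlim f F (locally k) -> filterlim g F (locally l) ->
  filterlim (fun t => f t * g t) F (locally (k * l)).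
Proof.
intros Hf Hg; apply (filterlim_comp_2 (G := locally k) (H := locally l)); auto.
exact (filterlim_mult (K := R_AbsRing) k l).
Qed.

Lemma at_left_of_locally' (t : R) (P : R -> Prop) :
  locally' t P -> at_left t P.
Proof. apply (filter_imp (F := locally t)); intros s H Hs; apply H; lra. Qed.

Lemma at_right_of_locally' (t : R) (P : R -> Prop) :
  locally' t P -> at_right t P.
Proof. apply (filter_imp (F := locally t)); intros s H Hs; apply H; lra. Qed.

Lemma locally'_of_sides (t : R) (P : R -> Prop) :
  at_left t P -> at_right t P -> locally' t P.
Proof.
intros Hl Hr; generalize (filter_and (F := locally t) _ _ Hl Hr).
apply (filter_imp (F := locally t)); intros s [H1 H2] Hs.
destruct (Rtotal_order s t) as [H|[H|H]]; [auto|easy|auto].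
Qed.

Lemma continuous_left_lim (f : R -> R) (t : R) :
  continuous f t -> left_lim f t (f t).
Proof. intros H; exact (filterlim_filter_le_1 f (filter_le_within (F := locally t) _) H). Qed.

Lemma continuous_right_lim (f : R -> R) (t : R) :
  continuous f t -> right_lim f t (f t).
Proof. intros H; exact (filterlim_filter_le_1 f (filter_le_within (F := locally t) _) H). Qed.

Lemma at_left_interval (p t : R) (P : R -> Prop) :
  p < t -> (forall s, p < s < t -> P s) -> at_left t P.
Proof.
intros Hp HP; generalize (open_gt p t Hp); apply (filter_imp (F := locally t)).
intros s H1 H2; apply HP; lra.
Qed.

Lemma at_right_interval (t q : R) (P : R -> Prop) :
  t < q -> (forall s, t < s < q -> P s) -> at_right t P.
Proof.
intros Hq HP; generalize (open_lt q t Hq); apply (filter_imp (F := locally t)).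
intros s H1 H2; apply HP; lra.
Qed.

Lemma filterlim_eventually_const {T : Type} (F : (T -> Prop) -> Prop)
    {FF : Filter F} (f : T -> R) (v : R) :
  F (fun t => f t = v) -> filterlim f F (locally v).
Proof.
intros H; apply (filterlim_ext_loc (fun _ => v)); [|apply filterlim_const].
now generalize H; apply filter_imp.
Qed.

Lemma filterlim_locally'_of_sides (f : R -> R) (t k : R) :
  left_lim f t k -> right_lim f t k -> filterlim f (locally' t) (locally k).
Proof.
intros Hl Hr P HP; apply locally'_of_sides; [now apply Hl|now apply Hr].
Qed.

Lemma left_lim_unique (f : R -> R) (t k l : R) :
  left_lim f t k -> left_lim f t l -> k = l.
Proof.
exact (filterlim_locally_unique (F := at_left t) (V := R_NormedModule) f k l).
Qed.

Lemma filterlim_Rabs {T : Type} (F : (T -> Prop) -> Prop) {FF : Filter F}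
    (f : T -> R) (k : R) :
  filterlim f F (locally k) ->
  filterlim (fun t => Rabs (f t)) F (locally (Rabs k)).
Proof.
intros H; exact (filterlim_comp _ _ _ f Rabs F _ _ H (continuous_Rabs k)).
Qed.

(** * Finitely many breakpoints *)

Lemma list_isolated (B : list R) (t : R) : locally' t (fun s => ~ In s B).
Proof.
induction B as [|p B IH]; [now apply filter_forall|].
assert (Hp : locally' t (fun s => s <> p)).
{ destruct (Req_dec t p) as [->|Hne]; [now apply (filter_forall (F := locally p))|].
  apply (filter_le_within (F := locally t)); exact (open_neq p t Hne). }
generalize (filter_and _ _ Hp IH); apply filter_imp.
intros s [H1 H2] [He|Hi]; [now apply H1|tauto].
Qed.

Lemma list_isolated_notin (B : list R) (t : R) :
  ~ In t B -> locally t (fun s => ~ In s B).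
Proof.
intros Ht; generalize (list_isolated B t); apply (filter_imp (F := locally t)).
intros s Hs Hi; destruct (Req_dec s t) as [->|Hne]; [tauto|now apply Hs].
Qed.

(** A relation between end points that holds on the pieces without inner
breakpoints, and can be glued at a breakpoint, holds on the whole interval. *)
Lemma piecewise_induction (P : R -> R -> Prop) (B : list R) (p q : R) :
  (forall r s, p <= r -> r < s -> s <= q ->
     (forall t, r < t < s -> ~ In t B) -> P r s) ->
  (forall r s t, p <= r -> r < s -> s < t -> t <= q ->
     In s B -> P r s -> P s t -> P r t) ->
  p < q -> P p q.
Proof.
intros Hbase Hglue Hpq.
(* Induction on a list l that contains the breakpoints inside the piece. *)
enough (Hind : forall l r s, p <= r -> r < s -> s <= q ->
  (forall t, r < t < s -> In t B -> In t l) -> P r s).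
{ apply (Hind B); auto; lra. }
induction l as [|b l IH]; intros r s Hr Hrs Hs Hl.
- apply Hbase; auto; intros t Ht Hi; exact (Hl t Ht Hi).
- destruct (classic (r < b < s /\ In b B)) as [[Hb HB]|Hb].
  + apply (Hglue r b s); try lra; auto; apply IH; try lra; intros t Ht Hi;
      (destruct (Hl t) as [->|H]; [lra|auto|lra|auto]).
  + apply IH; auto; intros t Ht Hi; destruct (Hl t Ht Hi) as [->|H]; tauto.
Qed.

(** A function whose derivative is nonnegative off finitely many points, and
whose jumps at these points go upwards, is nondecreasing. *)
Lemma piecewise_nondecreasing (G : R -> R) (B : list R) (p q gp gq : R) :
  p < q ->
  (forall t, p < t < q -> ~ In t B -> exists d, is_derive G t d /\ 0 <= d) ->
  (forall t, p < t < q -> In t B ->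
     exists k l, left_lim G t k /\ right_lim G t l /\ k <= l) ->
  right_lim G p gp -> left_lim G q gq -> gp <= gq.
Proof.
intros Hpq Hd Hj.
apply (piecewise_induction
  (fun r s => forall k l, right_lim G r k -> left_lim G s l -> k <= l) B p q);
  auto; clear gp gq.
- intros r s Hr Hrs Hs HB k l Hk Hl.
  assert (Hmono : forall v w, r < v -> v < w -> w < s -> G v <= G w).
  { intros v w Hv Hvw Hw.
    assert (HG : forall t, v <= t <= w -> exists d, is_derive G t d /\ 0 <= d).
    { intros t Ht; apply Hd; [lra|apply HB; lra]. }
    destruct (MVT_gen G v w (Derive G)) as [c [Hc He]];
      rewrite ?Rmin_left, ?Rmax_right in * by lra.
    - intros t Ht; destruct (HG t) as [d [H _]]; [lra|].
      now rewrite (is_derive_unique _ _ _ H).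
    - intros t Ht; destruct (HG t) as [d [H _]]; [lra|].
      apply continuity_pt_filterlim, (ex_derive_continuous (V := R_NormedModule)).
      now exists d.
    - destruct (HG c Hc) as [d [H Hdpos]].
      rewrite (is_derive_unique _ _ _ H) in He.
      enough (0 <= d * (w - v)) by lra; apply Rmult_le_pos; lra. }
  set (m := (r + s) / 2).
  assert (Hm : r < m < s) by (unfold m; lra).
  apply Rle_trans with (G m).
  + apply (filterlim_le (F := at_right r) G (fun _ => G m) k (G m)); auto.
    * apply (at_right_interval r m); [lra|]; intros t Ht; apply Hmono; lra.
    * apply filterlim_const.
  + apply (filterlim_le (F := at_left s) (fun _ => G m) G (G m) l); auto.
    * apply (at_left_interval m s); [lra|]; intros t Ht; apply Hmono; lra.
    * apply filterlim_const.
- intros r s t Hr Hrs Hst Ht Hs IH1 IH2 k l Hk Hl.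
  destruct (Hj s) as [k' [l' [Hk' [Hl' Hle]]]]; [lra|auto|].
  apply Rle_trans with k'; [now apply IH1|].
  apply Rle_trans with l'; [exact Hle|now apply IH2].
Qed.

(** * Piecewise continuous functions and their integrals *)

(** Piecewise continuity on the whole line, with breakpoints in the list B. *)
Definition piecewise_continuous (B : list R) (f : R -> R) : Prop :=
  (forall t, ~ In t B -> continuous f t) /\
  (forall t, (exists l, left_lim f t l) /\ (exists l, right_lim f t l)).

Lemma piecewise_continuous_incl (B B' : list R) (f : R -> R) :
  (forall t, In t B -> In t B') ->
  piecewise_continuous B f -> piecewise_continuous B' f.
Proof. intros HB [Hc Hl]; split; auto. Qed.

Lemma piecewise_continuous_mult (B : list R) (f g : R -> R) :
  piecewise_continuous B f -> (forall t, continuous g t) ->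
  piecewise_continuous B (fun t => f t * g t).
Proof.
intros [Hc Hl] Hg; split.
- intros t Ht; apply (filterlim_Rmult (locally t)); [now apply Hc|apply Hg].
- intros t; destruct (Hl t) as [[k Hk] [l Hr]]; split.
  + exists (k * g t); apply (filterlim_Rmult (at_left t)); [exact Hk|].
    apply continuous_left_lim, Hg.
  + exists (l * g t); apply (filterlim_Rmult (at_right t)); [exact Hr|].
    apply continuous_right_lim, Hg.
Qed.

Lemma piecewise_continuous_comp (B : list R) (f g : R -> R) :
  piecewise_continuous B f -> (forall t, continuous g t) ->
  piecewise_continuous B (fun t => g (f t)).
Proof.
intros [Hc Hl] Hg; split.
- intros t Ht; apply (continuous_comp f g); [now apply Hc|apply Hg].
- intros t; destruct (Hl t) as [[k Hk] [l Hr]]; split.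
  + exists (g k); exact (filterlim_comp _ _ _ f g _ _ _ Hk (Hg k)).
  + exists (g l); exact (filterlim_comp _ _ _ f g _ _ _ Hr (Hg l)).
Qed.

Lemma piecewise_continuous_ex_RInt (B : list R) (f : R -> R) (p q : R) :
  piecewise_continuous B f -> ex_RInt f p q.
Proof.
intros [Hc Hl].
assert (H : forall p q, p < q -> ex_RInt f p q).
{ clear p q; intros p q; apply (piecewise_induction (ex_RInt f) B p q).
  - intros r s _ Hrs _ HB.
    destruct (Hl r) as [_ [k Hk]]; destruct (Hl s) as [[l Hl'] _].
    destruct (C0_extension_lt f k l r s Hrs) as [g [Hg [He _]]]; auto.
    { intros t Ht; apply Hc, HB, Ht. }
    apply ex_RInt_ext with g.
    + rewrite Rmin_left, Rmax_right by lra; auto.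
    + apply (ex_RInt_continuous (V := R_CompleteNormedModule)); intros t _; apply Hg.
  - intros r s t _ _ _ _ _; apply ex_RInt_Chasles. }
destruct (Rtotal_order p q) as [Hpq|[->|Hpq]].
- now apply H.
- apply ex_RInt_point.
- apply ex_RInt_swap; now apply H.
Qed.

Lemma piecewise_continuous_RInt_continuous (B : list R) (f : R -> R) (p t : R) :
  piecewise_continuous B f -> continuous (RInt f p) t.
Proof.
intros Hf; apply (continuous_RInt_1 f p t).
apply filter_forall; intros s; apply (RInt_correct f).
now apply (piecewise_continuous_ex_RInt B).
Qed.

Lemma piecewise_continuous_RInt_derive (B : list R) (f : R -> R) (p t : R) :
  piecewise_continuous B f -> ~ In t B -> is_derive (RInt f p) t (f t).
Proof.
intros Hf Ht; apply (is_derive_RInt f (RInt f p) p t).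
- apply filter_forall; intros s; apply (RInt_correct f).
  now apply (piecewise_continuous_ex_RInt B).
- now apply Hf.
Qed.

(** * Filling removable discontinuities *)

(** If f has a limit at every point, its function of limits is continuous. *)
Lemma lim_continuous (f g : R -> R) :
  (forall t, filterlim f (locally' t) (locally (g t))) ->
  forall t, continuous g t.
Proof.
intros Hf t; apply filterlim_locally; intros eps.
assert (H := proj1 (filterlim_locally f (g t)) (Hf t) (pos_div_2 eps)).
generalize (locally_locally t _ H); apply filter_imp; intros s Hs.
destruct (Req_dec s t) as [->|Hne]; [apply ball_center|].
assert (Hnear : locally s (fun r => r <> t)) by exact (open_neq t s Hne).
assert (Hl := proj1 (filterlim_locally f (g s)) (Hf s) (pos_div_2 eps)).
apply at_right_of_locally' in Hl.
generalize (filter_and _ _ Hl (filter_le_within (F := locally s) _ _ (filter_and _ _ Hs Hnear))).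
intros Hr; destruct (filter_ex (F := at_right s) _ Hr) as [r [H1 [H2 H3]]].
rewrite <- (Rplus_half_diag eps); apply ball_triangle with (f r); [now apply H2|].
now apply ball_sym.
Qed.

(** * The energy inequality *)

Lemma continuous_Rmin_l (r t : R) : continuous (fun s => Rmin s r) t.
Proof.
apply (continuous_ext (fun s => (s + r - Rabs (s - r)) / 2)).
- intros s; unfold Rmin, Rabs; destruct (Rle_dec s r), (Rcase_abs (s - r)); lra.
- apply continuity_pt_filterlim; apply continuity_pt_mult; [|apply continuity_pt_const; now intros].
  apply continuity_pt_minus; [reg|].
  apply (continuity_pt_comp (fun s => s - r) Rabs); [reg|apply Rcontinuity_abs].
Qed.

Lemma continuous_Rmax_l (r t : R) : continuous (fun s => Rmax s r) t.
Proof.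
apply (continuous_ext (fun s => (s + r + Rabs (s - r)) / 2)).
- intros s; unfold Rmax, Rabs; destruct (Rle_dec s r), (Rcase_abs (s - r)); lra.
- apply continuity_pt_filterlim; apply continuity_pt_mult; [|apply continuity_pt_const; now intros].
  apply continuity_pt_plus; [reg|].
  apply (continuity_pt_comp (fun s => s - r) Rabs); [reg|apply Rcontinuity_abs].
Qed.

(** The derivative of G away from the breakpoints, up to its two forms on either
side of t0: e stands for the sign of x there, or its opposite. *)
Lemma energy_derivative_nonneg (a b c x u s E e M lam : R) :
  0 < b -> 0 < lam -> e * e = 1 -> x ^ 2 * s ^ 2 <= M ^ 2 ->
  0 <= lam * (b * (E * E)) + M ^ 2 / lam * Rmax c 0
    + ((a * x + b * u) * u + x * (- c * x - a * u)) * s ^ 2 / lam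
    - 2 * (e * b * u * s * E).
Proof.
intros Hb Hl He HM.
replace (_ - _) with
  (b / lam * (lam * E - e * u * s) ^ 2
   + (M ^ 2 * Rmax c 0 - c * (x ^ 2 * s ^ 2)) / lam).
2:{ replace ((lam * E - e * u * s) ^ 2)
      with (lam ^ 2 * E ^ 2 - 2 * lam * e * E * u * s + (e * e) * (u * s) ^ 2) by ring.
    rewrite He; field; lra. }
assert (Hlam : 0 < / lam) by now apply Rinv_0_lt_compat.
assert (Hm1 := Rmax_l c 0); assert (Hm2 := Rmax_r c 0).
assert (Hw : 0 <= x ^ 2 * s ^ 2) by (rewrite <- Rpow_mult_distr; apply pow2_ge_0).
apply Rplus_le_le_0_compat; apply Rmult_le_pos; try lra.
- apply Rmult_le_pos; lra.
- apply pow2_ge_0.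
- generalize (Rmult_le_compat_r (Rmax c 0) _ _ Hm2 HM).
  generalize (Rmult_le_compat_l _ _ _ Hw Hm1); lra.
Qed.

(** The comparison of G at both ends of the interval, in the form needed later:
sg is the weight w, S the step function which collects the jump terms, and the
hypothesis at the points of B says that K / lam + M^2 / lam * S does not jump
downwards there. The point t0, where Phi has a corner, is one of the
breakpoints. *)
Lemma energy_inequality (B : list R) (t1 t2 t0 : R) (a b c x u sg S Z : R -> R)
    (lam M s1 s2 : R) :
  t1 < t0 < t2 -> In t0 B -> 0 < lam ->
  piecewise_continuous B a -> piecewise_continuous B b ->
  piecewise_continuous B c ->
  (forall t, t1 < t < t2 -> ~ In t B ->
     0 < b t /\ x t <> 0 /\ Z t = Rabs (x t) * sg t /\
     is_derive x t (a t * x t + b t * u t) /\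
     is_derive u t (- c t * x t - a t * u t) /\
     locally t (fun s => sg s = sg t) /\ locally t (fun s => S s = S t)) ->
  (forall t, t1 < t < t2 -> In t B -> exists kl kr sl sr,
     left_lim (fun s => x s * u s * sg s ^ 2) t kl /\
     right_lim (fun s => x s * u s * sg s ^ 2) t kr /\
     left_lim S t sl /\ right_lim S t sr /\
     kl - kr <= M ^ 2 * (sr - sl)) ->
  (forall t, continuous Z t) -> (forall t, t1 <= t <= t2 -> 0 <= Z t <= M) ->
  Z t1 = 0 -> Z t0 = M -> Z t2 = 0 ->
  right_lim (fun s => x s * u s * sg s ^ 2) t1 0 ->
  left_lim (fun s => x s * u s * sg s ^ 2) t2 0 ->
  right_lim S t1 s1 -> left_lim S t2 s2 ->
  4 * M <= lam * RInt (fun t => b t * exp (- 2 * RInt a t0 t)) t1 t2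
    + M ^ 2 / lam * (RInt (fun t => Rmax (c t) 0) t1 t2 + (s2 - s1)).
Proof.
intros Ht0 HB0 Hlam Ha Hb Hc Hreg Hjump HZc HZM HZ1 HZ0 HZ2 HK1 HK2 HS1 HS2.
set (I := RInt a t0); set (E := fun t => exp (- I t)).
set (A := RInt (fun t => b t * exp (- 2 * I t)) t1).
set (C := RInt (fun t => Rmax (c t) 0) t1).
set (K := fun s => x s * u s * sg s ^ 2).
set (h := fun t => Z t * E t).
(* Equals -2 h to the left of t0 and 2 h - 4 M to its right, as h t0 = M. *)
set (Phi := fun t => - 2 * h (Rmin t t0) + (2 * h (Rmax t t0) - 2 * M)).
set (G := fun t => lam * A t + M ^ 2 / lam * (C t + S t) + K t / lam + Phi t).
assert (HI : forall t, continuous I t)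
  by (intros t; exact (piecewise_continuous_RInt_continuous B a t0 t Ha)).
assert (HE : forall t, continuous E t).
{ intros t; apply (continuous_comp (fun s => - I s) exp).
  - exact (continuous_opp (V := R_NormedModule) I t (HI t)).
  - apply continuous_exp. }
assert (Hh : forall t, continuous h t)
  by (intros t; exact (continuous_mult (K := R_AbsRing) Z E t (HZc t) (HE t))).
assert (Hbe : piecewise_continuous B (fun t => b t * exp (- 2 * I t))).
{ apply piecewise_continuous_mult; [exact Hb|]; intros t.
  apply (continuous_comp (fun s => - 2 * I s) exp).
  - exact (continuous_scal_r (V := R_NormedModule) (-2) I t (HI t)).
  - apply continuous_exp. }
assert (Hcp : piecewise_continuous B (fun t => Rmax (c t) 0)).
{ apply (piecewise_continuous_comp B c (fun s => Rmax s 0)); [exact Hc|].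
  apply continuous_Rmax_l. }
assert (HE0 : E t0 = 1).
{ unfold E, I; rewrite RInt_point; unfold zero; simpl.
  now rewrite Ropp_0, exp_0. }
assert (Hh0 : h t0 = M) by (unfold h; rewrite HE0, HZ0; ring).
assert (Hh1 : h t1 = 0) by (unfold h; rewrite HZ1; ring).
assert (Hh2 : h t2 = 0) by (unfold h; rewrite HZ2; ring).
assert (HA : forall t, continuous A t)
  by (intros t; exact (piecewise_continuous_RInt_continuous B _ t1 t Hbe)).
assert (HC : forall t, continuous C t)
  by (intros t; exact (piecewise_continuous_RInt_continuous B _ t1 t Hcp)).
assert (HPhi : forall t, continuous Phi t).
{ intros t; apply (filterlim_Rplus (locally t)).
  - apply (filterlim_Rmult (locally t)); [apply filterlim_const|].
    apply (continuous_comp (fun s => Rmin s t0) h); [apply continuous_Rmin_l|apply Hh].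
  - apply (filterlim_Rplus (locally t)); [|apply filterlim_const].
    apply (filterlim_Rmult (locally t)); [apply filterlim_const|].
    apply (continuous_comp (fun s => Rmax s t0) h); [apply continuous_Rmax_l|apply Hh]. }
assert (HPhi1 : Phi t1 = 0).
{ unfold Phi; rewrite Rmin_left, Rmax_right, Hh0, Hh1 by lra; ring. }
assert (HPhi2 : Phi t2 = - 4 * M).
{ unfold Phi; rewrite Rmin_right, Rmax_left, Hh0, Hh2 by lra; ring. }
assert (HGlim : forall F t k s, Filter F -> filter_le F (locally t) ->
  filterlim K F (locally k) -> filterlim S F (locally s) ->
  filterlim G F
    (locally (lam * A t + M ^ 2 / lam * (C t + s) + k / lam + Phi t))).
{ intros F t k s HF HFt HK HS.
  apply filterlim_Rplus; [exact HF|apply filterlim_Rplus|]; [exact HF|apply filterlim_Rplus| |];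
    [exact HF| | | |].
  - apply filterlim_Rmult; [exact HF|apply filterlim_const|].
    exact (filterlim_filter_le_1 A HFt (HA t)).
  - apply filterlim_Rmult; [exact HF|apply filterlim_const|].
    apply filterlim_Rplus; [exact HF| |exact HS].
    exact (filterlim_filter_le_1 C HFt (HC t)).
  - apply filterlim_Rmult; [exact HF|exact HK|apply filterlim_const].
  - exact (filterlim_filter_le_1 Phi HFt (HPhi t)). }
assert (Hle : lam * A t1 + M ^ 2 / lam * (C t1 + s1) + 0 / lam + Phi t1 <=
              lam * A t2 + M ^ 2 / lam * (C t2 + s2) + 0 / lam + Phi t2).
{ apply (piecewise_nondecreasing G B t1 t2); [lra| | | |].
  - intros t Ht HtB.
    destruct (Hreg t Ht HtB) as [Hbt [Hxt [HZt [Hx [Hu [Hsg HS]]]]]].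
    assert (Hne : t <> t0) by (intros ->; contradiction).
    assert (HAd := piecewise_continuous_RInt_derive B _ t1 t Hbe HtB).
    assert (HCd := piecewise_continuous_RInt_derive B _ t1 t Hcp HtB).
    assert (HId := piecewise_continuous_RInt_derive B _ t0 t Ha HtB).
    fold A in HAd; fold C in HCd; fold I in HId; cbv beta in HAd, HCd.
    assert (Hxd := is_derive_Rabs x t _ Hx Hxt).
    set (ax := fun s => Rabs (x s)) in Hxd.
    assert (Hsign : sign (x t) * sign (x t) = 1 /\ sign (x t) * x t = Rabs (x t)).
    { destruct (Rdichotomy _ _ Hxt) as [H|H].
      - rewrite sign_eq_m1, Rabs_left by easy; lra.
      - rewrite sign_eq_1, Rabs_right by lra; lra. }
    destruct Hsign as [Hs1 Hs2].
    assert (HZloc : locally t (fun s => Z s = ax s * sg t)).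
    { assert (Hin : locally t (fun s => t1 < s < t2))
        by exact (filter_and _ _ (open_gt t1 t (proj1 Ht)) (open_lt t2 t (proj2 Ht))).
      generalize (filter_and _ _ Hin
        (filter_and _ _ (list_isolated_notin B t HtB) Hsg)).
      apply filter_imp; intros s [H1 [H2 H3]].
      rewrite <- H3; exact (proj1 (proj2 (proj2 (Hreg s H1 H2)))). }
    assert (Hsq : x t ^ 2 * sg t ^ 2 <= M ^ 2).
    { rewrite <- (pow2_abs (x t)), <- Rpow_mult_distr, <- HZt.
      apply pow_incr, HZM; lra. }
    assert (HEE : exp (- 2 * I t) = E t * E t).
    { unfold E; rewrite <- exp_plus; f_equal; ring. }
    (* Near t, Phi is - 2 e Z E up to a constant. *)
    set (e := if Rlt_dec t t0 then 1 else -1).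
    assert (He : e * e = 1) by (unfold e; destruct (Rlt_dec t t0); ring).
    assert (HPloc : locally t (fun s => Phi s = - 2 * e * (Z s * E s)
                                          - (if Rlt_dec t t0 then 0 else 4 * M))).
    { unfold e; destruct (Rlt_dec t t0) as [Hlt|Hge].
      - generalize (open_lt t0 t Hlt); apply filter_imp; intros s Hs.
        unfold Phi; rewrite Rmin_left, Rmax_right, Hh0 by lra; unfold h; ring.
      - generalize (open_gt t0 t ltac:(lra)); apply filter_imp; intros s Hs.
        unfold Phi; rewrite Rmin_right, Rmax_left, Hh0 by lra; unfold h; ring. }
    set (r := if Rlt_dec t t0 then 0 else 4 * M) in HPloc.
    eexists; split.
    + apply (is_derive_ext_loc (fun s => lam * A s + M ^ 2 / lam * (C s + S t)
        + x s * u s * sg t ^ 2 / lam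
        + (- 2 * e * (ax s * sg t * exp (- I s)) - r))).
      { generalize (filter_and _ _ (filter_and _ _ Hsg HS) (filter_and _ _ HZloc HPloc)).
        apply filter_imp; intros s [[H1 H2] [H3 H4]].
        unfold G, K; rewrite H1, H2, H4, H3; reflexivity. }
      auto_derive.
      * repeat split; try (eexists; eassumption).
      * reflexivity.
    + replace (Derive (fun s => A s) t) with (b t * exp (- 2 * I t))
        by (symmetry; exact (is_derive_unique _ _ _ HAd)).
      replace (Derive (fun s => C s) t) with (Rmax (c t) 0)
        by (symmetry; exact (is_derive_unique _ _ _ HCd)).
      replace (Derive (fun s => I s) t) with (a t)
        by (symmetry; exact (is_derive_unique _ _ _ HId)).
      replace (Derive (fun s => x s) t) with (a t * x t + b t * u t)
        by (symmetry; exact (is_derive_unique _ _ _ Hx)).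
      replace (Derive (fun s => u s) t) with (- c t * x t - a t * u t)
        by (symmetry; exact (is_derive_unique _ _ _ Hu)).
      replace (Derive (fun s => ax s) t)
        with (sign (x t) * (a t * x t + b t * u t))
        by (symmetry; exact (is_derive_unique _ _ _ Hxd)).
      fold (E t); rewrite HEE; unfold ax; rewrite <- Hs2.
      eapply Rle_trans; [apply (energy_derivative_nonneg (a t) (b t) (c t) (x t)
        (u t) (sg t) (E t) (e * sign (x t)) M lam Hbt Hlam); [|exact Hsq]|].
      * rewrite <- Hs1; transitivity (e * e * (sign (x t) * sign (x t))); [ring|].
        rewrite He; ring.
      * apply Req_le; unfold Rdiv; ring.
  - intros t Ht HtB.
    destruct (Hjump t Ht HtB) as [kl [kr [sl [sr [H1 [H2 [H3 [H4 H5]]]]]]]].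
    do 2 eexists; split; [|split].
    + apply (HGlim (at_left t) t kl sl); auto; [apply _|].
      apply (filter_le_within (F := locally t)).
    + apply (HGlim (at_right t) t kr sr); auto; [apply _|].
      apply (filter_le_within (F := locally t)).
    + assert (Hinv : 0 < / lam) by now apply Rinv_0_lt_compat.
      generalize (Rmult_le_compat_r (/ lam) _ _ (Rlt_le _ _ Hinv) H5); unfold Rdiv; lra.
  - apply (HGlim (at_right t1) t1 0 s1); auto; [apply _|].
    apply (filter_le_within (F := locally t1)).
  - apply (HGlim (at_left t2) t2 0 s2); auto; [apply _|].
    apply (filter_le_within (F := locally t2)). }
rewrite HPhi1, HPhi2 in Hle.
assert (HA1 : A t1 = 0) by exact (RInt_point t1 _).
assert (HC1 : C t1 = 0) by exact (RInt_point t1 _).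
replace (M ^ 2 / lam * (C t2 + (s2 - s1)))
  with (M ^ 2 / lam * (C t2 + s2) - M ^ 2 / lam * (0 + s1)) by ring.
rewrite HA1, HC1 in Hle; fold I; fold (A t2); lra.
Qed.

(** * Impulse points and step functions *)

Lemma impulse_points_injective (tau : Z -> R) :
  (forall i : Z, tau i < tau (i + 1)%Z) ->
  forall i j : Z, tau i = tau j -> i = j.
Proof.
intros Hinc.
assert (Hlt : forall (i : Z) (n : nat), tau i < tau (i + Z.of_nat (S n))%Z).
{ intros i n; induction n as [|n IH]; [apply Hinc|].
  apply Rlt_trans with (1 := IH).
  replace (i + Z.of_nat (S (S n)))%Z with (i + Z.of_nat (S n) + 1)%Z by lia.
  apply Hinc. }
assert (Hlt' : forall i j : Z, (i < j)%Z -> tau i < tau j).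
{ intros i j Hij; generalize (Hlt i (Z.to_nat (j - i - 1))).
  now replace (i + Z.of_nat (S (Z.to_nat (j - i - 1))))%Z with j by lia. }
intros i j Hij; destruct (Z.lt_trichotomy i j) as [H|[H|H]]; auto;
  apply Hlt' in H; lra.
Qed.

Lemma Finite_list {U : Type} (P : U -> Prop) :
  Finite_sets.Finite U P -> exists l : list U, NoDup l /\ forall i, In i l <-> P i.
Proof.
induction 1 as [|P HP [l [Hl Hi]] y Hy].
- exists nil; split; [constructor|]; intros i; split; intros [].
- exists (y :: l); split.
  + constructor; [|easy]; now rewrite Hi.
  + intros i; simpl; rewrite Hi; split.
    * intros [->|H]; [right; constructor|now left].
    * intros [z Hz|z Hz]; [now right|left; now destruct Hz].
Qed.

(** The left-continuous step function which jumps by g i at tau i, for each i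
in l, and vanishes far on the left. *)
Definition step (tau : Z -> R) (l : list Z) (g : Z -> R) (t : R) : R :=
  fold_right Rplus 0 (map (fun i => if Rlt_dec (tau i) t then g i else 0) l).

Lemma step_ge_0 (tau : Z -> R) (l : list Z) (g : Z -> R) (t : R) :
  (forall i, 0 <= g i) -> 0 <= step tau l g t.
Proof.
intros Hg; induction l as [|i l IH]; unfold step in *; simpl; [lra|].
destruct (Rlt_dec (tau i) t); generalize (Hg i); lra.
Qed.

Lemma step_above (tau : Z -> R) (l : list Z) (g : Z -> R) (t : R) :
  (forall i, In i l -> tau i < t) -> step tau l g t = fold_right Rplus 0 (map g l).
Proof.
intros Hl; unfold step; f_equal; apply map_ext_in; intros i Hi.
destruct (Rlt_dec (tau i) t) as [_|H]; [easy|now apply Hl in Hi].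
Qed.

Lemma step_left (tau : Z -> R) (l : list Z) (g : Z -> R) (t : R) :
  at_left t (fun s => step tau l g s = step tau l g t).
Proof.
induction l as [|i l IH]; [now apply (filter_forall (F := at_left t))|].
assert (Hi : at_left t (fun s => tau i < s <-> tau i < t)).
{ destruct (Rlt_dec (tau i) t) as [H|H].
  - apply (at_left_interval (tau i) t); [easy|]; intros; lra.
  - apply (at_left_interval (t - 1) t); [lra|]; intros; lra. }
generalize (filter_and (F := at_left t) _ _ Hi IH).
apply (filter_imp (F := at_left t)); intros s [H1 H2].
unfold step in *; simpl; rewrite H2.
destruct (Rlt_dec (tau i) s), (Rlt_dec (tau i) t); tauto.
Qed.

Lemma step_right_notin (tau : Z -> R) (l : list Z) (g : Z -> R) (t : R) :
  (forall i, In i l -> tau i <> t) ->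
  at_right t (fun s => step tau l g s = step tau l g t).
Proof.
induction l as [|i l IH]; intros Hl; [now apply (filter_forall (F := at_right t))|].
assert (Hi : at_right t (fun s => tau i < s <-> tau i < t)).
{ assert (Hne := Hl i (or_introl eq_refl)).
  destruct (Rlt_dec (tau i) t) as [H|H].
  - apply (at_right_interval t (t + 1)); [lra|]; intros; lra.
  - apply (at_right_interval t (tau i)); [lra|]; intros; lra. }
generalize (filter_and (F := at_right t) _ _ Hi
  (IH (fun j Hj => Hl j (or_intror Hj)))).
apply (filter_imp (F := at_right t)); intros s [H1 H2].
unfold step in *; simpl; rewrite H2.
destruct (Rlt_dec (tau i) s), (Rlt_dec (tau i) t); tauto.
Qed.

Lemma step_right_jump (tau : Z -> R) (l : list Z) (g : Z -> R) (j : Z) :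
  (forall i k, tau i = tau k -> i = k) -> NoDup l -> In j l ->
  at_right (tau j) (fun s => step tau l g s = step tau l g (tau j) + g j).
Proof.
intros Hinj; induction l as [|i l IH]; intros Hnd Hj; [destruct Hj|].
apply NoDup_cons_iff in Hnd; destruct Hnd as [Hni Hnd].
destruct (Z.eq_dec i j) as [->|Hij].
- assert (Hl : forall k, In k l -> tau k <> tau j).
  { intros k Hk He; apply Hinj in He; now subst. }
  generalize (step_right_notin tau l g (tau j) Hl).
  apply (filter_imp (F := locally (tau j))); intros s H Hs; specialize (H Hs).
  unfold step in *; simpl; rewrite H.
  destruct (Rlt_dec (tau j) s), (Rlt_dec (tau j) (tau j)); lra.
- destruct Hj as [Hj|Hj]; [easy|].
  assert (Hi : at_right (tau j) (fun s => tau i < s <-> tau i < tau j)).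
  { assert (Hne : tau i <> tau j) by (intros H; now apply Hij, Hinj).
    destruct (Rlt_dec (tau i) (tau j)) as [H|H].
    - apply (at_right_interval _ (tau j + 1)); [lra|]; intros; lra.
    - apply (at_right_interval _ (tau i)); [lra|]; intros; lra. }
  generalize (filter_and (F := at_right (tau j)) _ _ Hi (IH Hnd Hj)).
  apply (filter_imp (F := at_right (tau j))); intros s [H1 H2].
  unfold step in *; simpl; rewrite H2.
  destruct (Rlt_dec (tau i) s), (Rlt_dec (tau i) (tau j)); try tauto; ring.
Qed.

Lemma step_locally (tau : Z -> R) (l : list Z) (g : Z -> R) (t : R) :
  (forall i, In i l -> tau i <> t) ->
  locally t (fun s => step tau l g s = step tau l g t).
Proof.
intros Hl.
generalize (locally'_of_sides t _ (step_left tau l g t) (step_right_notin tau l g t Hl)).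
apply (filter_imp (F := locally t)); intros s H.
destruct (Req_dec s t) as [->|Hne]; auto.
Qed.

Lemma step_right_ex (tau : Z -> R) (l : list Z) (g : Z -> R) (t : R) :
  (forall i k, tau i = tau k -> i = k) -> NoDup l ->
  exists v, at_right t (fun s => step tau l g s = v).
Proof.
intros Hinj Hnd; destruct (classic (exists j, In j l /\ tau j = t)) as [[j [Hj <-]]|H].
- eexists; now apply step_right_jump.
- eexists; apply step_right_notin; intros i Hi He; apply H; now exists i.
Qed.

(** * From the interval to the line *)

(** The indices of the impulse points in [t1, t2), without repetition. *)
Definition impulse_list (tau : Z -> R) (t1 t2 : R) (l : list Z) : Prop :=
  NoDup l /\ forall i, In i l <-> t1 <= tau i < t2.

(** All points of [t1, t2] at which the data may be discontinuous. *)
Definition breakpoints (tau : Z -> R) (t1 t2 : R) (l : list Z) : list R :=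
  t1 :: t2 :: map tau l.

(** The function equal to f on the open interval (t1, t2) and to 0 elsewhere,
end points included. *)
Definition truncate (t1 t2 : R) (f : R -> R) (t : R) : R :=
  if Rlt_dec t1 t then if Rlt_dec t t2 then f t else 0 else 0.

Lemma truncate_in (t1 t2 : R) (f : R -> R) (t : R) :
  t1 < t < t2 -> truncate t1 t2 f t = f t.
Proof.
intros Ht; unfold truncate; destruct (Rlt_dec t1 t), (Rlt_dec t t2); lra.
Qed.

Lemma truncate_out (t1 t2 : R) (f : R -> R) (t : R) :
  t <= t1 \/ t2 <= t -> truncate t1 t2 f t = 0.
Proof.
intros Ht; unfold truncate; destruct (Rlt_dec t1 t), (Rlt_dec t t2); lra.
Qed.

Lemma notin_breakpoints (tau : Z -> R) (t1 t2 : R) (l : list Z) (t : R) :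
  impulse_list tau t1 t2 l -> t1 < t < t2 ->
  ~ In t (breakpoints tau t1 t2 l) <-> forall i, t <> tau i.
Proof.
intros [_ Hl] Ht; split.
- intros HB i ->; apply HB; do 2 right; apply in_map, Hl; lra.
- intros Hi [H|[H|H]]; [lra|lra|].
  apply in_map_iff in H; destruct H as [i [H _]]; now apply (Hi i).
Qed.

Lemma impulse_free_locally (tau : Z -> R) (t1 t2 : R) (l : list Z) (t : R) :
  impulse_list tau t1 t2 l -> t1 < t < t2 -> (forall i, t <> tau i) ->
  locally t (impulse_free tau t1 t2).
Proof.
intros Hl Ht Hi.
assert (HB := proj2 (notin_breakpoints tau t1 t2 l t Hl Ht) Hi).
generalize (filter_and _ _ (list_isolated_notin _ t HB)
  (filter_and _ _ (open_gt t1 t (proj1 Ht)) (open_lt t2 t (proj2 Ht)))).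
apply filter_imp; intros s [H1 H2]; split; [lra|].
now apply (notin_breakpoints tau t1 t2 l s Hl H2).
Qed.

Lemma impulse_free_at_right (tau : Z -> R) (t1 t2 : R) (l : list Z) (t : R) :
  impulse_list tau t1 t2 l -> t1 <= t < t2 ->
  at_right t (impulse_free tau t1 t2).
Proof.
intros Hl Ht.
generalize (filter_and (F := at_right t) _ _
  (at_right_of_locally' t _ (list_isolated (breakpoints tau t1 t2 l) t))
  (at_right_interval t t2 (fun s => t < s < t2) (proj2 Ht) (fun s H => H))).
apply (filter_imp (F := at_right t)); intros s [H1 H2].
assert (H3 : t1 < s < t2) by lra; split; [lra|].
now apply (notin_breakpoints tau t1 t2 l s Hl H3).
Qed.

Lemma impulse_free_at_left (tau : Z -> R) (t1 t2 : R) (l : list Z) (t : R) :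
  impulse_list tau t1 t2 l -> t1 < t <= t2 ->
  at_left t (impulse_free tau t1 t2).
Proof.
intros Hl Ht.
generalize (filter_and (F := at_left t) _ _
  (at_left_of_locally' t _ (list_isolated (breakpoints tau t1 t2 l) t))
  (at_left_interval t1 t (fun s => t1 < s < t) (proj1 Ht) (fun s H => H))).
apply (filter_imp (F := at_left t)); intros s [H1 H2].
assert (H3 : t1 < s < t2) by lra; split; [lra|].
now apply (notin_breakpoints tau t1 t2 l s Hl H3).
Qed.

Lemma PC_continuous (tau : Z -> R) (t1 t2 : R) (l : list Z) (f : R -> R) (t : R) :
  impulse_list tau t1 t2 l -> PC tau t1 t2 f -> t1 < t < t2 ->
  (forall i, t <> tau i) -> continuous f t.
Proof.
intros Hl [Hf _] Ht Hi.
apply (continuous_continuous_on (impulse_free tau t1 t2)); [|exact Hf].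
now apply (impulse_free_locally tau t1 t2 l).
Qed.

Lemma PC_right_lim (tau : Z -> R) (t1 t2 : R) (l : list Z) (f : R -> R) (t : R) :
  impulse_list tau t1 t2 l -> PC tau t1 t2 f -> t1 <= t < t2 ->
  exists k, right_lim f t k.
Proof.
intros Hl [Hf [_ Hlim]] Ht.
destruct (classic (exists i, t = tau i)) as [[i ->]|Hi]; [now apply Hlim|].
exists (f t); intros P HP.
assert (Hfree : impulse_free tau t1 t2 t).
{ split; [lra|]; intros i He; apply Hi; now exists i. }
generalize (filter_and (F := locally t) _ _ (Hf t Hfree P HP)
  (impulse_free_at_right tau t1 t2 l t Hl Ht)).
apply (filter_imp (F := locally t)); intros s [H1 H2] Hs; now apply H1, H2.
Qed.

Lemma PC_left_lim (tau : Z -> R) (t1 t2 : R) (l : list Z) (f : R -> R) (t : R) :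
  impulse_list tau t1 t2 l -> PC tau t1 t2 f -> t1 < t <= t2 ->
  exists k, left_lim f t k.
Proof.
intros Hl [Hf [Hlim _]] Ht.
destruct (classic (exists i, t = tau i)) as [[i ->]|Hi]; [now apply Hlim|].
exists (f t); intros P HP.
assert (Hfree : impulse_free tau t1 t2 t).
{ split; [lra|]; intros i He; apply Hi; now exists i. }
generalize (filter_and (F := locally t) _ _ (Hf t Hfree P HP)
  (impulse_free_at_left tau t1 t2 l t Hl Ht)).
apply (filter_imp (F := locally t)); intros s [H1 H2] Hs; now apply H1, H2.
Qed.

Lemma truncate_right_lim (t1 t2 : R) (f : R -> R) (t k : R) :
  t1 <= t < t2 -> right_lim f t k -> right_lim (truncate t1 t2 f) t k.
Proof.
intros Ht; apply (filterlim_ext_loc (F := at_right t)).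
apply (at_right_interval t t2); [lra|]; intros s Hs; rewrite truncate_in; lra.
Qed.

Lemma truncate_left_lim (t1 t2 : R) (f : R -> R) (t k : R) :
  t1 < t <= t2 -> left_lim f t k -> left_lim (truncate t1 t2 f) t k.
Proof.
intros Ht; apply (filterlim_ext_loc (F := at_left t)).
apply (at_left_interval t1 t); [lra|]; intros s Hs; rewrite truncate_in; lra.
Qed.

Lemma truncate_right_lim_out (t1 t2 : R) (f : R -> R) (t : R) :
  t < t1 \/ t2 <= t -> right_lim (truncate t1 t2 f) t 0.
Proof.
intros Ht; apply (filterlim_ext_loc (F := at_right t) (fun _ => 0));
  [|apply filterlim_const].
destruct Ht as [Ht|Ht].
- apply (at_right_interval t t1); [lra|]; intros s Hs; rewrite truncate_out; lra.
- apply (at_right_interval t (t + 1)); [lra|]; intros s Hs; rewrite truncate_out; lra.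
Qed.

Lemma truncate_left_lim_out (t1 t2 : R) (f : R -> R) (t : R) :
  t <= t1 \/ t2 < t -> left_lim (truncate t1 t2 f) t 0.
Proof.
intros Ht; apply (filterlim_ext_loc (F := at_left t) (fun _ => 0));
  [|apply filterlim_const].
destruct Ht as [Ht|Ht].
- apply (at_left_interval (t - 1) t); [lra|]; intros s Hs; rewrite truncate_out; lra.
- apply (at_left_interval t2 t); [lra|]; intros s Hs; rewrite truncate_out; lra.
Qed.

Lemma PC_truncate (tau : Z -> R) (t1 t2 : R) (l : list Z) (f : R -> R) :
  impulse_list tau t1 t2 l -> PC tau t1 t2 f ->
  piecewise_continuous (breakpoints tau t1 t2 l) (truncate t1 t2 f).
Proof.
intros Hl Hf; split.
- intros t HtB; destruct (Rlt_dec t t1) as [H1|H1]; [|destruct (Rlt_dec t2 t) as [H2|H2]].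
  + apply (continuous_ext_loc _ (fun _ => 0) t); [|apply continuous_const].
    generalize (open_lt t1 t H1); apply filter_imp; intros s Hs.
    rewrite truncate_out; lra.
  + apply (continuous_ext_loc _ (fun _ => 0) t); [|apply continuous_const].
    generalize (open_gt t2 t H2); apply filter_imp; intros s Hs.
    rewrite truncate_out; lra.
  + assert (Ht : t1 < t < t2).
    { assert (t <> t1) by (intros ->; apply HtB; now left).
      assert (t <> t2) by (intros ->; apply HtB; right; now left). lra. }
    apply (continuous_ext_loc _ f t).
    * generalize (filter_and _ _ (open_gt t1 t (proj1 Ht)) (open_lt t2 t (proj2 Ht))).
      apply filter_imp; intros s Hs; now rewrite truncate_in.
    * apply (PC_continuous tau t1 t2 l); auto.
      now apply (notin_breakpoints tau t1 t2 l).
- intros t; split.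
  + destruct (Rlt_dec t1 t) as [H1|H1]; [destruct (Rle_dec t t2) as [H2|H2]|].
    * destruct (PC_left_lim tau t1 t2 l f t Hl Hf (conj H1 H2)) as [k Hk].
      exists k; now apply truncate_left_lim.
    * exists 0; apply truncate_left_lim_out; lra.
    * exists 0; apply truncate_left_lim_out; lra.
  + destruct (Rle_dec t1 t) as [H1|H1]; [destruct (Rlt_dec t t2) as [H2|H2]|].
    * destruct (PC_right_lim tau t1 t2 l f t Hl Hf (conj H1 H2)) as [k Hk].
      exists k; now apply truncate_right_lim.
    * exists 0; apply truncate_right_lim_out; lra.
    * exists 0; apply truncate_right_lim_out; lra.
Qed.

(** * Solutions *)

Lemma D_in_continuous_within (f d : R -> R) (D : R -> Prop) (t : R) :
  D_in f d D t -> filterlim f (within D (locally t)) (locally (f t)).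
Proof.
intros H; apply cont_deriv in H; apply filterlim_locally; intros eps.
destruct (H eps (cond_pos eps)) as [r [Hr Hd]].
exists (mkposreal r Hr); intros s Hs HD.
destruct (Req_dec s t) as [->|Hne]; [apply ball_center|].
apply (Hd s); split; [|exact Hs]; split; [exact HD|congruence].
Qed.

Lemma D_in_is_derive (f d : R -> R) (D : R -> Prop) (t : R) :
  locally t D -> D_in f d D t -> is_derive f t (d t).
Proof.
intros [r HD] H; apply is_derive_Reals; intros eps Heps.
destruct (H eps Heps) as [r' [Hr' Hd]].
assert (Hm : 0 < Rmin r r') by (apply Rmin_pos; [apply cond_pos|easy]).
exists (mkposreal _ Hm); intros h Hh Hhr; simpl in Hhr.
assert (H1 := Rmin_l r r'); assert (H2 := Rmin_r r r').
assert (Hball : Rabs (t + h - t) < Rmin r r') by (now replace (t + h - t) with h by ring).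
specialize (Hd (t + h)); simpl in Hd; unfold R_dist, Rdist in Hd.
replace ((f (t + h) - f t) / h) with ((f (t + h) - f t) / (t + h - t))
  by (f_equal; ring).
apply Hd; split; [split; [|lra]|lra].
apply HD; change (Rabs (t + h - t) < r); lra.
Qed.

Lemma solution_PC (tau alpha beta : Z -> R) (a b c : R -> R) (t1 t2 : R)
    (x u : R -> R) :
  is_solution tau alpha beta a b c t1 t2 x u -> PC tau t1 t2 x /\ PC tau t1 t2 u.
Proof.
intros [Hd [Hx [Hu _]]]; split; (split; [|assumption]);
  intros t Ht; destruct (Hd t Ht); eapply D_in_continuous_within; eassumption.
Qed.

(** The product of the 1 / |alpha i| over the i in l with tau i < t: multiplying
|x| by it removes the jumps of |x|. *)
Definition weight (tau alpha : Z -> R) (l : list Z) (t : R) : R :=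
  exp (- step tau l (fun i => ln (Rabs (alpha i))) t).

Lemma weight_pos (tau alpha : Z -> R) (l : list Z) (t : R) :
  0 < weight tau alpha l t.
Proof. apply exp_pos. Qed.

Lemma weight_left (tau alpha : Z -> R) (l : list Z) (t : R) :
  left_lim (weight tau alpha l) t (weight tau alpha l t).
Proof.
apply (filterlim_eventually_const (at_left t)).
generalize (step_left tau l (fun i => ln (Rabs (alpha i))) t).
apply (filter_imp (F := at_left t)); intros s H; unfold weight; now rewrite H.
Qed.

Lemma weight_right_jump (tau alpha : Z -> R) (l : list Z) (j : Z) :
  (forall i k, tau i = tau k -> i = k) -> NoDup l -> In j l -> alpha j <> 0 ->
  right_lim (weight tau alpha l) (tau j) (weight tau alpha l (tau j) / Rabs (alpha j)).
Proof.
intros Hinj Hnd Hj Ha; apply (filterlim_eventually_const (at_right (tau j))).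
generalize (step_right_jump tau l (fun i => ln (Rabs (alpha i))) j Hinj Hnd Hj).
apply (filter_imp (F := at_right (tau j))); intros s H; unfold weight; rewrite H.
rewrite Ropp_plus_distr, exp_plus, (exp_Ropp (ln _)), exp_ln; [reflexivity|].
now apply Rabs_pos_lt.
Qed.

Lemma weight_locally (tau alpha : Z -> R) (l : list Z) (t : R) :
  (forall i, In i l -> tau i <> t) ->
  locally t (fun s => weight tau alpha l s = weight tau alpha l t).
Proof.
intros H; generalize (step_locally tau l (fun i => ln (Rabs (alpha i))) t H).
apply filter_imp; intros s Hs; unfold weight; now rewrite Hs.
Qed.

Lemma weight_right_ex (tau alpha : Z -> R) (l : list Z) (t : R) :
  (forall i k, tau i = tau k -> i = k) -> NoDup l ->
  exists v, right_lim (weight tau alpha l) t v.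
Proof.
intros Hinj Hnd.
destruct (step_right_ex tau l (fun i => ln (Rabs (alpha i))) t Hinj Hnd) as [v Hv].
exists (exp (- v)); apply (filterlim_eventually_const (at_right t)).
revert Hv; apply (filter_imp (F := at_right t)).
intros s H; unfold weight; now rewrite H.
Qed.

(** The function |x| times its weight extends continuously, by 0 at the end
points, through the impulse points. *)
Lemma solution_amplitude (tau alpha beta : Z -> R) (a b c : R -> R) (t1 t2 : R)
    (l : list Z) (x u : R -> R) :
  t1 < t2 -> (forall i k, tau i = tau k -> i = k) -> (forall i, alpha i <> 0) ->
  impulse_list tau t1 t2 l ->
  is_solution tau alpha beta a b c t1 t2 x u ->
  right_lim x t1 0 -> left_lim x t2 0 ->
  exists Z : R -> R, (forall t, continuous Z t) /\ Z t1 = 0 /\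
    forall t k, t1 < t <= t2 -> left_lim x t k ->
      Z t = Rabs k * weight tau alpha l t.
Proof.
intros Ht12 Hinj Ha Hl Hsol Hx1 Hx2.
destruct (solution_PC _ _ _ _ _ _ _ _ _ _ Hsol) as [HPx _].
set (w := weight tau alpha l).
set (Z0 := truncate t1 t2 (fun s => Rabs (x s) * w s)).
assert (Hleft : forall t k, t1 < t <= t2 -> left_lim x t k ->
  left_lim Z0 t (Rabs k * w t)).
{ intros t k Ht Hk; apply truncate_left_lim; [easy|].
  apply (filterlim_Rmult (at_left t)); [|apply weight_left].
  now apply (filterlim_Rabs (at_left t)). }
assert (Hlim : forall t, exists k, filterlim Z0 (locally' t) (locally k)).
{ intros t.
  destruct (Rlt_dec t t1) as [H1|H1];
    [|destruct (Rlt_dec t2 t) as [H2|H2];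
      [|destruct (Req_dec t t1) as [->|H3]; [|destruct (Req_dec t t2) as [->|H4]]]].
  - exists 0; apply filterlim_locally'_of_sides;
      [apply truncate_left_lim_out|apply truncate_right_lim_out]; lra.
  - exists 0; apply filterlim_locally'_of_sides;
      [apply truncate_left_lim_out|apply truncate_right_lim_out]; lra.
  - exists 0; apply filterlim_locally'_of_sides; [apply truncate_left_lim_out; lra|].
    apply truncate_right_lim; [lra|].
    destruct (weight_right_ex tau alpha l t1 Hinj (proj1 Hl)) as [v Hv].
    replace 0 with (Rabs 0 * v) by (rewrite Rabs_R0; ring).
    apply (filterlim_Rmult (at_right t1)); [|exact Hv].
    now apply (filterlim_Rabs (at_right t1)).
  - exists 0; apply filterlim_locally'_of_sides; [|apply truncate_right_lim_out; lra].
    replace 0 with (Rabs 0 * w t2) by (rewrite Rabs_R0; ring).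
    apply Hleft; [lra|exact Hx2].
  - assert (Ht : t1 < t < t2) by lra.
    destruct (classic (exists i, t = tau i)) as [[i ->]|Hi].
    + destruct (proj2 (proj2 (proj2 Hsol)) i Ht)
        as [xl [xr [_ [_ [Hxl [Hxr [_ [_ [He _]]]]]]]]].
      exists (Rabs xl * w (tau i)); apply filterlim_locally'_of_sides;
        [apply Hleft; [lra|easy]|].
      apply truncate_right_lim; [lra|].
      replace (Rabs xl * w (tau i)) with (Rabs xr * (w (tau i) / Rabs (alpha i))).
      2:{ rewrite He, Rabs_mult; field; now apply Rabs_no_R0. }
      apply (filterlim_Rmult (at_right (tau i))).
      * now apply (filterlim_Rabs (at_right (tau i))).
      * apply weight_right_jump; auto; [apply Hl|apply Hl; lra].
    + assert (Hi' : forall i, t <> tau i) by (intros i He; apply Hi; now exists i).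
      assert (Hxc := PC_continuous tau t1 t2 l x t Hl HPx Ht Hi').
      exists (Rabs (x t) * w t); apply filterlim_locally'_of_sides.
      * apply Hleft; [lra|]; now apply continuous_left_lim.
      * apply truncate_right_lim; [lra|].
        apply (filterlim_Rmult (at_right t)).
        -- apply (filterlim_Rabs (at_right t)); now apply continuous_right_lim.
        -- apply (filterlim_eventually_const (at_right t)).
           apply (filter_le_within (F := locally t)), weight_locally.
           intros i _ He; now apply (Hi' i). }
exists (fun t => proj1_sig (constructive_indefinite_description _ (Hlim t))).
set (Z := fun t => _).
assert (HZ : forall t, filterlim Z0 (locally' t) (locally (Z t)))
  by (intros t; exact (proj2_sig (constructive_indefinite_description _ (Hlim t)))).
assert (HZl : forall t, left_lim Z0 t (Z t))
  by (intros t P HP; apply at_left_of_locally'; now apply HZ).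
split; [|split].
- exact (lim_continuous Z0 Z HZ).
- apply (left_lim_unique Z0 t1); [apply HZl|apply truncate_left_lim_out; lra].
- intros t k Ht Hk; apply (left_lim_unique Z0 t); [apply HZl|now apply Hleft].
Qed.

(** * The inequality *)

Lemma sum_over_list (P Q : Z -> Prop) (f : Z -> R) :
  Finite_sets.Finite Z Q -> (forall i, P i -> Q i) ->
  exists l, NoDup l /\ (forall i, In i l <-> P i) /\
    sum_over P f = fold_right Rplus 0 (map f l).
Proof.
intros HQ HPQ; unfold sum_over; apply epsilon_spec.
destruct (Finite_list Q HQ) as [l [Hnd Hin]].
set (p := fun i => if excluded_middle_informative (P i) then true else false).
exists (fold_right Rplus 0 (map f (filter p l))), (filter p l); repeat split.
- now apply NoDup_filter.
- intros Hi; apply filter_In in Hi; destruct Hi as [_ Hi]; unfold p in Hi.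
  now destruct (excluded_middle_informative (P i)).
- intros Hi; apply filter_In; split; [now apply Hin, HPQ|unfold p].
  now destruct (excluded_middle_informative (P i)).
Qed.

(** The discriminant condition for the quadratic polynomial
lam^2 A - 4 M lam + M^2 C to be nonnegative at all positive lam. *)
Lemma product_ge_4 (M A C : R) :
  0 < M -> (forall lam, 0 < lam -> 4 * M <= lam * A + M ^ 2 / lam * C) ->
  A * C >= 4.
Proof.
intros HM H.
assert (HA : 0 < A).
{ apply Rnot_le_lt; intros HA.
  (* For large lam the second term is at most M. *)
  set (lam := M * Rabs C + 1).
  assert (HC := Rabs_pos C); assert (HC' := Rle_abs C).
  assert (Hlam : 0 < lam) by (unfold lam; nra).
  specialize (H lam Hlam).
  assert (H1 : M ^ 2 / lam * C <= M).
  { replace (M ^ 2 / lam * C) with (M * (M * C) / lam) by (field; lra).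
    apply Rle_div_l; [lra|]; unfold lam; nra. }
  nra. }
specialize (H (2 * M / A) ltac:(apply Rdiv_lt_0_compat; lra)).
replace (2 * M / A * A + M ^ 2 / (2 * M / A) * C) with (2 * M + M * (A * C) / 2) in H
  by (field; lra).
nra.
Qed.

Theorem theorem5p1 (tau alpha beta : Z -> R) (t1 t2 : R) (a b c : R -> R)
    (htau : forall i : Z, tau i < tau (i + 1)%Z)
    (ht : t1 < t2)
    (hfin : Finite_sets.Finite Z (fun i : Z => t1 <= tau i <= t2))
    (ha : PC tau t1 t2 a) (hb : PC tau t1 t2 b) (hc : PC tau t1 t2 c)
    (hbpos : forall t : R, impulse_free tau t1 t2 t -> 0 < b t)
    (halpha : forall i : Z, alpha i <> 0)
    (hsol : exists x u : R -> R,
       is_solution tau alpha beta a b c t1 t2 x u /\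
       right_lim x t1 0 /\ left_lim x t2 0 /\
       (forall s : R, t1 < s < t2 -> ~ is_zero x s)) :
  exists t0 : R, t1 < t0 < t2 /\
    RInt (fun t => b t * exp (- 2 * RInt a t0 t)) t1 t2 *
    (RInt (fun t => Rmax (c t) 0) t1 t2 +
     sum_over (fun i : Z => t1 <= tau i < t2)
              (fun i : Z => Rmax (beta i / alpha i) 0)) >= 4.
Proof.
destruct hsol as [x [u [Hsol [Hx1 [Hx2 Hzero]]]]].
assert (Hinj := impulse_points_injective tau htau).
set (g := fun i : Z => Rmax (beta i / alpha i) 0).
destruct (sum_over_list (fun i => t1 <= tau i < t2) _ g hfin)
  as [l [Hnd [Hin Hsum]]]; [intros i Hi; lra|].
rewrite Hsum; assert (Hl : impulse_list tau t1 t2 l) by (split; assumption).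
destruct (solution_PC _ _ _ _ _ _ _ _ _ _ Hsol) as [HPx HPu].
destruct (solution_amplitude tau alpha beta a b c t1 t2 l x u) as [Z [HZc [HZ1 HZ]]];
  auto.
set (w := weight tau alpha l) in *.
assert (HZ2 : Z t2 = 0).
{ rewrite (HZ t2 0), Rabs_R0; [ring|lra|easy]. }
assert (HZpos : forall t, t1 <= t <= t2 -> 0 <= Z t).
{ intros t Ht; destruct (Req_dec t t1) as [->|Hne]; [lra|].
  assert (Ht' : t1 < t <= t2) by lra.
  destruct (PC_left_lim tau t1 t2 l x t Hl HPx Ht') as [k Hk].
  rewrite (HZ t k Ht' Hk); apply Rmult_le_pos; [apply Rabs_pos|].
  apply Rlt_le, weight_pos. }
assert (Hreg : forall t, t1 < t < t2 -> (forall i, t <> tau i) ->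
  x t <> 0 /\ Z t = Rabs (x t) * w t).
{ intros t Ht Hi.
  assert (Hxl := continuous_left_lim x t
    (PC_continuous tau t1 t2 l x t Hl HPx Ht Hi)).
  split; [|apply HZ; [lra|easy]].
  intros H0; apply (Hzero t Ht); left; now rewrite H0 in Hxl. }
destruct (continuity_ab_maj Z t1 t2) as [t0 [Hmax Ht0]]; [lra| |].
{ intros t _; apply continuity_pt_filterlim, HZc. }
set (M := Z t0).
assert (HM : 0 < M).
{ (* Z is positive at any impulse-free point s of (t1, t2). *)
  destruct (filter_ex (F := at_right t1) _ (filter_and (F := at_right t1) _ _
    (impulse_free_at_right tau t1 t2 l t1 Hl (conj (Rle_refl t1) ht))
    (at_right_interval t1 t2 (fun s => t1 < s < t2) ht (fun s H => H))))
    as [s [[_ Hs1] Hs2]].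
  destruct (Hreg s Hs2 Hs1) as [H1 H2].
  apply Rlt_le_trans with (Z s); [|apply Hmax; lra].
  rewrite H2; apply Rmult_lt_0_compat; [now apply Rabs_pos_lt|apply weight_pos]. }
assert (Ht0' : t1 < t0 < t2).
{ assert (t0 <> t1) by (intros ->; unfold M in HM; lra).
  assert (t0 <> t2) by (intros ->; unfold M in HM; lra). lra. }
exists t0; split; [exact Ht0'|].
apply (product_ge_4 M); [exact HM|]; intros lam Hlam.
set (B := t0 :: breakpoints tau t1 t2 l).
assert (HB : forall f, PC tau t1 t2 f -> piecewise_continuous B (truncate t1 t2 f)).
{ intros f Hf; apply (piecewise_continuous_incl (breakpoints tau t1 t2 l));
    [now right|now apply PC_truncate]. }
assert (HK : forall (F : (R -> Prop) -> Prop) p q v, Filter F ->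
  filterlim x F (locally p) -> filterlim u F (locally q) ->
  filterlim w F (locally v) ->
  filterlim (fun s => x s * u s * w s ^ 2) F (locally (p * q * v ^ 2))).
{ intros F p q v HF Hp Hq Hv; apply filterlim_Rmult; [exact HF| |].
  - now apply filterlim_Rmult.
  - apply filterlim_Rmult; [exact HF|exact Hv|].
    apply filterlim_Rmult; [exact HF|exact Hv|apply filterlim_const]. }
assert (Hgpos : forall i, 0 <= g i) by (intros i; apply Rmax_r).
destruct (step_right_ex tau l g t1 Hinj Hnd) as [s1 Hs1].
assert (Hs1pos : 0 <= s1).
{ destruct (filter_ex (F := at_right t1) _ Hs1) as [s <-]; now apply step_ge_0. }
destruct (weight_right_ex tau alpha l t1 Hinj Hnd) as [v1 Hv1].
destruct (PC_right_lim tau t1 t2 l u t1 Hl HPu (conj (Rle_refl t1) ht)) as [u1 Hu1].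
destruct (PC_left_lim tau t1 t2 l u t2 Hl HPu (conj ht (Rle_refl t2))) as [u2 Hu2].
assert (Hen := energy_inequality B t1 t2 t0 (truncate t1 t2 a) (truncate t1 t2 b)
  (truncate t1 t2 c) x u w (step tau l g) Z lam M s1
  (fold_right Rplus 0 (map g l)) Ht0' (or_introl eq_refl) Hlam
  (HB a ha) (HB b hb) (HB c hc)).
assert (HRa : forall t, t1 < t < t2 -> RInt (truncate t1 t2 a) t0 t = RInt a t0 t).
{ intros t Ht; apply RInt_ext; intros s Hs; apply truncate_in.
  assert (t1 < Rmin t0 t) by (apply Rmin_glb_lt; lra).
  assert (Rmax t0 t < t2) by (apply Rmax_lub_lt; lra). lra. }
assert (HRb : RInt (fun t => truncate t1 t2 b t * exp (- 2 * RInt (truncate t1 t2 a) t0 t)) t1 t2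
  = RInt (fun t => b t * exp (- 2 * RInt a t0 t)) t1 t2).
{ apply RInt_ext; rewrite Rmin_left, Rmax_right by lra; intros t Ht.
  now rewrite truncate_in, HRa. }
assert (HRc : RInt (fun t => Rmax (truncate t1 t2 c t) 0) t1 t2
  = RInt (fun t => Rmax (c t) 0) t1 t2).
{ apply RInt_ext; rewrite Rmin_left, Rmax_right by lra; intros t Ht.
  now rewrite truncate_in. }
rewrite HRb, HRc in Hen; eapply Rle_trans; [apply Hen; clear Hen|].
- intros t Ht HtB; assert (Hi : forall i, t <> tau i).
  { apply (notin_breakpoints tau t1 t2 l t Hl Ht); intros H; apply HtB; now right. }
  assert (Hloc := impulse_free_locally tau t1 t2 l t Hl Ht Hi).
  assert (Hfree := locally_singleton _ _ Hloc).
  destruct (proj1 Hsol t Hfree) as [Hdx Hdu].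
  destruct (Hreg t Ht Hi) as [Hx0 HZt].
  rewrite !truncate_in by easy.
  refine (conj _ (conj Hx0 (conj HZt (conj _ (conj _ (conj _ _)))))).
  + now apply hbpos.
  + exact (D_in_is_derive _ _ _ _ Hloc Hdx).
  + exact (D_in_is_derive _ _ _ _ Hloc Hdu).
  + apply weight_locally; intros i _ He; now apply (Hi i).
  + apply step_locally; intros i _ He; now apply (Hi i).
- intros t Ht _; destruct (classic (exists i, t = tau i)) as [[i ->]|Hi].
  + destruct (proj2 (proj2 (proj2 Hsol)) i Ht)
      as [xl [xr [ul [ur [Hxl [Hxr [Hul [Hur [Hex Heu]]]]]]]]].
    assert (Hi : In i l) by (apply Hin; lra).
    exists (xl * ul * w (tau i) ^ 2), (xr * ur * (w (tau i) / Rabs (alpha i)) ^ 2),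
      (step tau l g (tau i)), (step tau l g (tau i) + g i).
    split; [|split; [|split; [|split]]].
    * apply (HK (at_left (tau i))); [apply _|exact Hxl|exact Hul|apply weight_left].
    * apply (HK (at_right (tau i))); [apply _|exact Hxr|exact Hur|].
      now apply weight_right_jump.
    * apply (filterlim_eventually_const (at_left (tau i))), step_left.
    * apply (filterlim_eventually_const (at_right (tau i))).
      now apply step_right_jump.
    * assert (HZi : (xl * w (tau i)) ^ 2 <= M ^ 2).
      { rewrite <- pow2_abs, Rabs_mult, (Rabs_pos_eq (w _))
          by (apply Rlt_le, weight_pos).
        rewrite <- (HZ (tau i) xl) by (auto; lra).
        apply pow_incr; split; [apply HZpos|apply Hmax]; lra. }
      replace (xl * ul * w (tau i) ^ 2 - xr * ur * (w (tau i) / Rabs (alpha i)) ^ 2)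
        with (beta i / alpha i * (xl * w (tau i)) ^ 2).
      2:{ rewrite Hex, Heu.
          replace ((w (tau i) / Rabs (alpha i)) ^ 2)
            with (w (tau i) ^ 2 / alpha i ^ 2)
            by (rewrite <- (pow2_abs (alpha i)); field; now apply Rabs_no_R0).
          field; apply halpha. }
      assert (Hg1 : beta i / alpha i <= g i) by apply Rmax_l.
      assert (Hg2 := Hgpos i); assert (Hw := pow2_ge_0 (xl * w (tau i))).
      generalize (Rmult_le_compat_r _ _ _ Hw Hg1).
      generalize (Rmult_le_compat_l _ _ _ Hg2 HZi); lra.
  + assert (Hi' : forall i, t <> tau i) by (intros i He; apply Hi; now exists i).
    assert (HKc : filterlim (fun s => x s * u s * w s ^ 2) (locally t)
      (locally (x t * u t * w t ^ 2))).
    { apply HK; [apply _| | |].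
      - now apply (PC_continuous tau t1 t2 l x t).
      - now apply (PC_continuous tau t1 t2 l u t).
      - apply filterlim_eventually_const; [apply _|].
        apply weight_locally; intros i _ He; now apply (Hi' i). }
    assert (HSc : filterlim (step tau l g) (locally t) (locally (step tau l g t))).
    { apply filterlim_eventually_const; [apply _|].
      apply step_locally; intros i _ He; now apply (Hi' i). }
    do 4 eexists; split; [|split; [|split; [|split]]].
    * apply continuous_left_lim, HKc.
    * apply continuous_right_lim, HKc.
    * apply continuous_left_lim, HSc.
    * apply continuous_right_lim, HSc.
    * lra.
- exact HZc.
- intros t Ht; split; [now apply HZpos|now apply Hmax].
- exact HZ1.
- reflexivity.
- exact HZ2.
- replace 0 with (0 * u1 * v1 ^ 2) by ring.
  apply (HK (at_right t1)); [apply _|exact Hx1|exact Hu1|exact Hv1].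
- replace 0 with (0 * u2 * w t2 ^ 2) by ring.
  apply (HK (at_left t2)); [apply _|exact Hx2|exact Hu2|apply weight_left].
- now apply (filterlim_eventually_const (at_right t1)).
- rewrite <- (step_above tau l g t2) by (intros i Hi; apply Hin in Hi; lra).
  apply (filterlim_eventually_const (at_left t2)), step_left.
- apply Rplus_le_compat_l, Rmult_le_compat_l; [|lra].
  apply Rlt_le, Rdiv_lt_0_compat; [apply pow_lt, HM|exact Hlam].
Qed.
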